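(* Let $X$ and $Y$ be real locally convex topological vector spaces and let $F\colon X\rightrightarrows Y$ be a convex set-valued mapping such that $\operatorname{int}(F(x))\neq\emptyset$ for all $x\in\operatorname{dom}(F)$. Then $$\operatorname{sqri}(\operatorname{gph}(F))=\{(x,y)\in X\times Y\mid x\in\operatorname{sqri}(\operatorname{dom}(F)),\ y\in\operatorname{sqri}(F(x))\}.$$
   Context: A set-valued mapping $F\colon X\rightrightarrows Y$ assigns to each $x\in X$ a (possibly empty) subset $F(x)\subset Y$; $\operatorname{dom}(F)=\{x\in X\mid F(x)\neq\emptyset\}$ and $\operatorname{gph}(F)=\{(x,y)\in X\times Y\mid y\in F(x)\}$. $F$ is called convex if $\operatorname{gph}(F)$ is a convex subset of $X\times Y$ (with the product topology on $X\times Y$). $\operatorname{int}$ denotes the topological interior. For a set $\Omega$, $\operatorname{cone}(\Omega)=\{\lambda w\mid \lambda\ge 0,\ w\in\Omega\}$. The strong quasi-relative interior of a subset $\Omega$ of a topological vector space $Z$ is $\operatorname{sqri}(\Omega)=\{z\in\Omega\mid \operatorname{cone}(\Omega-z)\text{ is a closed linear subspace of }Z\}$. *)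

(* Defs.v *)
From HB Require Import structures.
From mathcomp Require Import all_boot all_order all_algebra.
From mathcomp Require Import all_classical all_reals all_analysis.

Set Implicit Arguments.
Unset Strict Implicit.
Unset Printing Implicit Defensive.

Import Order.TTheory GRing.Theory Num.Theory.

Local Open Scope classical_set_scope.
Local Open Scope ring_scope.

(* A set-valued mapping from X to Y is a function X -> set Y; its values may
   be empty. *)

Definition dom (X Y : Type) (F : X -> set Y) : set X := [set x | F x !=set0].

Definition gph (X Y : Type) (F : X -> set Y) : set (X * Y) :=
  [set xy | F xy.1 xy.2].

Definition convex_mapping (R : numDomainType) (X Y : lmodType R)
    (F : X -> set Y) : Prop :=
  convex_set (gph F : set (convex_lmodType (X * Y)%type)).

Definition cone (R : numDomainType) (Z : lmodType R) (A : set Z) : set Z :=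
  [set u | exists l : R, exists w : Z, [/\ 0 <= l, A w & u = l *: w]].

Definition sqri (R : numDomainType) (Z : topologicalLmodType R)
    (A : set Z) : set Z :=
  [set z | A z /\ let C := cone [set w - z | w in A] in
                  closed C /\ submod_closed [in C]].

(* Main.v *)
Require Import Defs.
From mathcomp Require Import all_boot all_order all_algebra.
From mathcomp Require Import all_classical all_reals all_analysis.
From mathcomp Require Import ring lra.

(** Everything is decided by the cones of rays [l *: (w - z)] from a point [z]
    into a set, whose being closed subspaces defines [sqri]. Fix [(x, y)] in the
    graph of [F], with graph cone [C], domain cone [L] and fiber cone [V].

    A vertical ray of the graph stays over [x], so [V] is the slice of [C] above
    [0] ([radial_fiber]); hence if [C] is a subspace, so is [V]. A subspace that
    arises as the cone of a set with interior points is the whole space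
    ([radial_interior_setT]). So, whichever side of the equality [(x, y)] is
    assumed to belong to, [V] is all of [Y].

    Once [V] is all of [Y], convexity gives [C = L * Y] ([radial_gph]), and such
    a product is a closed subspace exactly when [L] is, which matches the
    remaining conditions on the two sides. *)

Set Implicit Arguments.
Unset Strict Implicit.
Unset Printing Implicit Defensive.

Import Order.TTheory GRing.Theory Num.Theory.

Local Open Scope classical_set_scope.
Local Open Scope ring_scope.

Local Notation radial A z := (cone [set w - z | w in A]).

Lemma radialP (R : numDomainType) (Z : lmodType R) (A : set Z) (z u : Z) :
  radial A z u <-> exists l w, [/\ 0 <= l, A w & u = l *: (w - z)].
Proof.
split=> [[l [_ [l0 [w Aw <-] ->]]]|[l [w [l0 Aw ->]]]]; first by exists l, w.
by exists l, (w - z); split=> //; exists w.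
Qed.

Lemma submod_closed_setP (R : numDomainType) (Z : lmodType R) (C : set Z) :
  submod_closed [in C] <->
  C 0 /\ forall a u v, C u -> C v -> C (a *: u + v).
Proof.
split=> -[C0 Clin].
  split=> [|a u v Cu Cv]; first exact: set_mem.
  by apply/set_mem/Clin; apply/mem_set.
split=> [|a u v /set_mem Cu /set_mem Cv]; first exact/mem_set.
exact/mem_set/Clin.
Qed.

(** Two rays from [z] into [A] with weights [l] and [m] combine into a ray of
    weight [l + m] towards the barycentre of their tips, which convexity keeps
    in [A]. *)
Lemma radialD (R : realType) (Z : lmodType R) (A : set Z) (z u v : Z) :
  convex_set (A : set (convex_lmodType Z)) ->
  radial A z u -> radial A z v -> radial A z (u + v).
Proof.
move=> convA /radialP[l [w [l0 Aw ->]]] /radialP[m [w' [m0 Aw' ->]]].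
apply/radialP; have [lm0|lm_neq0] := eqVneq (l + m) 0.
  have [-> ->] : l = 0 /\ m = 0 by lra.
  by exists 0, w; rewrite !scale0r addr0.
have lm_gt0 : 0 < l + m by rewrite lt_neqAle eq_sym lm_neq0 addr_ge0.
have p0 : 0 <= l / (l + m) by rewrite divr_ge0 // ltW.
have p1 : l / (l + m) <= 1 by rewrite ler_pdivrMr // mul1r lerDl.
have /set_mem Ab := convA w w' (Itv01 p0 p1) (mem_set Aw) (mem_set Aw').
exists (l + m), (conv (Itv01 p0 p1) (w : convex_lmodType Z) w').
split; [exact: ltW | exact: Ab |].
have -> : conv (Itv01 p0 p1) (w : convex_lmodType Z) w' =
  (l / (l + m)) *: w + (1 - l / (l + m)) *: w' :> Z by [].
rewrite [in RHS]scalerBr [in RHS]scalerDr !scalerA.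
have -> : (l + m) * (l / (l + m)) = l by field.
have -> : (l + m) * (1 - l / (l + m)) = m by field.
by rewrite !scalerBr scalerDl opprD addrACA.
Qed.

(** From an interior point [w0] of [A] every direction [v] can be followed for
    a positive time [t] without leaving [A]; then [t *: v] is the difference of
    the two radial vectors [w0 + t *: v - z] and [w0 - z], and a subspace
    containing it contains [v]. *)
Lemma radial_interior_setT (R : realType) (Z : topologicalLmodType R)
    (A : set Z) (z : Z) :
  A^° !=set0 -> submod_closed [in radial A z] -> radial A z = setT.
Proof.
move=> [w0 intA] /submod_closed_setP[C0 Clin]; rewrite -subTset => v _.
have cont : (fun t : R^o => w0 + t *: v) @ (0 : R^o) --> w0.
  have sc : (fun t : R^o => t *: v) @ (0 : R^o) --> (0 *: v : Z).
    apply: (@continuous2_cvg _ _ _ _ (nbhs (0 : R^o)) _ id (fun=> v)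
      (fun (t : R^o) (u : Z) => t *: u)); last exact: cvg_cst.
    - exact: (@scale_continuous _ _ (0, v)).
    - exact: cvg_id.
  rewrite -[X in _ --> X]addr0 -[X in _ --> w0 + X](scale0r v).
  apply: (@continuous2_cvg _ _ _ _ (nbhs (0 : R^o)) _ (fun=> w0) _
    (fun w u : Z => w + u)); last exact: sc.
  - exact: (@add_continuous _ (w0, _)).
  - exact: cvg_cst.
have [e /= e0 He] : nbhs (0 : R^o) [set t | A (w0 + t *: v)].
  exact: (cont _ intA).
have e2 : 0 < e / 2 by rewrite divr_gt0.
have Aw1 : A (w0 + (e / 2) *: v).
  by apply: He; rewrite /= sub0r normrN gtr0_norm //; lra.
have radA w : A w -> radial A z (w - z).
  by move=> Aw; apply/radialP; exists 1, w; rewrite scale1r.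
have Aw0 : A w0 by exact: nbhs_singleton intA.
have Cv : radial A z ((e / 2) *: v).
  have := Clin (-1) _ _ (radA _ Aw0) (radA _ Aw1).
  by rewrite scaleN1r addrC opprB addrA subrK addrAC subrr add0r.
have := Clin (e / 2)^-1 _ _ Cv C0.
by rewrite addr0 scalerA mulVf ?scale1r // gt_eqF.
Qed.

(** For sets with interior points closedness is automatic, because the cone is
    the whole space; this leaves a condition free of topology. *)
Lemma sqri_interiorE (R : realType) (Z : topologicalLmodType R) (A : set Z)
    (z : Z) :
  A^° !=set0 -> sqri A z <-> A z /\ radial A z = setT.
Proof.
move=> intA; split=> [[Az [_ subC]]|[Az CT]]; split=> //.
  exact: radial_interior_setT.
by rewrite /= CT; split; [exact: closedT | exact/submod_closed_setP].
Qed.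

Section RadialGraph.
Variables (R : realType) (X Y : lmodType R) (F : X -> set Y).

(** The ray from [(x, y)] to a point of the graph is vertical only if that
    point lies over [x] or the weight is zero. *)
Lemma radial_fiber x y v :
  F x y -> radial (F x) y v <-> radial (gph F) (x, y) (0, v).
Proof.
move=> Fxy; split=> /radialP.
  move=> [l [w [l0 Fw ->]]]; apply/radialP; exists l, (x, w); split=> //.
  by congr pair; rewrite /= subrr scaler0.
move=> [l [[x' y'] [l0 /= Fy' [/esym/eqP xE ->]]]]; apply/radialP.
move: xE; rewrite scaler_eq0 => /orP[/eqP ->|].
  by exists 0, y; rewrite !scale0r.
by rewrite subr_eq0 => /eqP xE; subst x'; exists l, y'.
Qed.

(** When the fiber fills all vertical directions at [(x, y)], a ray of the
    domain, lifted arbitrarily to the graph, can be corrected vertically to any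
    prescribed second component. *)
Lemma radial_gph x y :
  convex_mapping F -> F x y -> radial (F x) y = setT ->
  radial (gph F) (x, y) = radial (dom F) x `*` setT.
Proof.
move=> convF Fxy fibT; apply/seteqP; split=> -[u v].
  move=> /radialP[l [[x' y'] [l0 /= Fy' [-> _]]]]; split=> //.
  by apply/radialP; exists l, x'; split=> //; exists y'.
move=> [/= /radialP[l [x' [l0 [y' Fy'] ->]]] _].
rewrite (_ : (_, v) = l *: ((x', y') - (x, y)) + (0, v - l *: (y' - y))).
  apply: radialD => //; first by apply/radialP; exists l, (x', y').
  by apply/radial_fiber => //; rewrite fibT.
by congr pair; rewrite /= ?addr0 // addrC subrK.
Qed.

End RadialGraph.

(** The point [y] provides the continuous section [x |-> (x, y)] along which [L]
    is recovered from the product; for empty [Y] the product would be empty, and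
    closed, whatever [L]. *)
Lemma closed_setXT (X Y : topologicalType) (y : Y) (L : set X) :
  closed (L `*` [set: Y]) <-> closed L.
Proof.
split=> [clLY|clL].
  have -> : L = (fun x => (x, y)) @^-1` (L `*` setT).
    by apply/seteqP; split=> [x Lx|x []].
  apply: preimage_closed clLY => x _.
  by apply: cvg_pair => /=; [exact: cvg_id | exact: cvg_cst].
rewrite setXT; apply: preimage_closed clL => x _; exact: cvg_fst.
Qed.

Lemma submod_closed_setXT (R : numDomainType) (X Y : lmodType R) (L : set X) :
  submod_closed [in L `*` [set: Y]] <-> submod_closed [in L].
Proof.
rewrite !submod_closed_setP; split=> [[[L0 _] Llin]|[L0 Llin]].
  split=> // a u v Lu Lv.
  by have [] := Llin a (u, 0) (v, 0) (conj Lu I) (conj Lv I).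
split=> // a [u ?] [v ?] [Lu _] [Lv _]; split=> //; exact: Llin.
Qed.

Theorem theorem4p4 (R : realType) (X Y : tvsType R) (F : X -> set Y)
    (convF : convex_mapping F)
    (intF : forall x : X, dom F x -> interior (F x) !=set0) :
  sqri (gph F) = [set xy : X * Y | sqri (dom F) xy.1 /\ sqri (F xy.1) xy.2].
Proof.
have key x y : F x y -> radial (F x) y = setT ->
    sqri (gph F) (x, y) <-> sqri (dom F) x.
  move=> Fxy fibT; have CE := radial_gph convF Fxy fibT.
  have domx : dom F x by exists y.
  rewrite /sqri /= CE.
  split=> -[_ []].
    by move=> /(closed_setXT y) ? /submod_closed_setXT ?.
  by move=> /(closed_setXT y) ? /(submod_closed_setXT Y) ?.
apply/seteqP; split=> -[x y] /=.
  move=> sq; have [Fxy [_ /submod_closed_setP[C0 Clin]]] := sq.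
  have intFx : (F x)^° !=set0 by apply: intF; exists y.
  have fibT : radial (F x) y = setT.
    apply: radial_interior_setT => //; apply/submod_closed_setP; split.
      exact/radial_fiber.
    move=> a u v /radial_fiber-/(_ Fxy) Cu /radial_fiber-/(_ Fxy) Cv.
    apply/radial_fiber => //.
    rewrite (_ : (0, _) = a *: ((0, u) : X * Y) + (0, v)); first exact: Clin.
    by congr pair; rewrite /= scaler0 addr0.
  by split; [exact/(key x y) | exact/sqri_interiorE].
move=> [sqx /sqri_interiorE[|Fxy fibT]]; last exact/key.
by apply: intF; case: sqx.
Qed.
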